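(* Let $0<\mu<b$, $0\le d\le\frac{2\mu(b-\mu)}{b}$, and let the demand $D$ have a distribution $\mathbb{P}\in\mathcal{P}_{(\mu,b,d)}$. Let $p>c>0$ and $\eta=(p-c)/p$. Then the optimal order quantity $q^*$ for $\max_q\mathbb{E}_{\mathbb{P}}[\pi(q,D)]$ is contained in the interval $[q^L,q^U]$ given by $$[q^L,q^U]=\begin{cases}\Big[0,\ \frac{2\mu(b-\mu)-bd}{2(b-\mu)(1-\eta)-d}\Big], & \text{if } \eta<\frac{d}{2\mu},\\[4pt] \Big[\mu-\frac{d}{2\eta},\ \mu+\frac{d}{2(1-\eta)}\Big], & \text{if } \frac{d}{2\mu}\le\eta\le 1-\frac{d}{2(b-\mu)},\\[4pt] \Big[\frac{\mu-b(1-\eta)}{\eta-d/(2\mu)},\ b\Big], & \text{if } \eta> 1-\frac{d}{2(b-\mu)}.\end{cases}$$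
   Context: $\mathcal{P}_{(\mu,b,d)}$ is the set of all Borel probability measures $\mathbb{P}$ (the distribution of the random demand $D$) such that $\mathbb{P}(D\in[0,b])=1$, $\mathbb{E}_{\mathbb{P}}[D]=\mu$ and $\mathbb{E}_{\mathbb{P}}[|D-\mu|]=d$. The newsvendor profit is $\pi(q,D)=p\min\{q,D\}-cq$, where $q$ is the order quantity, $p$ the selling price and $c$ the purchase cost per unit, $p>c$. The optimal order quantity is the critical quantile $q^*=\min\{q : \mathbb{P}(D\le q)\ge\eta\}$ with $\eta=(p-c)/p$, which maximizes $q\mapsto\mathbb{E}_{\mathbb{P}}[\pi(q,D)]$. *)

(* Defs.v *)
From HB Require Import structures.
From mathcomp Require Import all_boot all_order all_algebra.
From mathcomp Require Import all_classical all_reals all_analysis.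
Import Order.TTheory GRing.Theory Num.Theory.
Import numFieldNormedType.Exports.

Set Implicit Arguments.
Unset Strict Implicit.
Unset Printing Implicit Defensive.

Local Open Scope classical_set_scope.
Local Open Scope ring_scope.

(* A distribution of the demand is a Borel probability measure on R, the demand
   itself then being the coordinate x.  Although 'E_P[_] is a total operator
   with values in the extended reals, the support condition makes both
   integrands bounded almost surely, so the expectations are genuine. *)
Definition ambiguity_set (R : realType) (mu b d : R) :
    set (probability R R) :=
  [set P : probability R R |
    [/\ P `[0, b]%classic = 1%E,
        'E_P[fun x => x]%E = mu%:E
      & 'E_P[fun x => `|x - mu|%R]%E = d%:E]].

Definition profit (R : realType) (p c q x : R) : R := p * Num.min q x - c * q.

Definition expected_profit (dT : measure_display) (T : measurableType dT)
    (R : realType) (Pr : probability T R) (D : {RV Pr >-> R}) (p c q : R) :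
    \bar R :=
  'E_Pr[fun t => profit p c q (D t)]%E.

Definition critical_ratio (R : realType) (p c : R) : R := (p - c) / p.

(* [q] is the minimum, not merely the infimum, of the set of all order
   quantities whose service level Pr(D <= q) is at least the critical ratio. *)
Definition optimal_order_quantity (dT : measure_display)
    (T : measurableType dT) (R : realType) (Pr : probability T R)
    (D : {RV Pr >-> R}) (p c q : R) : Prop :=
  let S := [set x | ((critical_ratio p c)%:E <= cdf D x)%E] in
  S q /\ lbound S q.

(* For the admissible range of [d] one has
   d / (2 mu) <= 1 - d / (2 (b - mu)), so the three cases are disjoint. *)
Definition order_interval (R : realType) (mu b d eta : R) : interval R :=
  if eta < d / (2 * mu) then
    `[0, (2 * mu * (b - mu) - b * d) / (2 * (b - mu) * (1 - eta) - d)]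
  else if eta <= 1 - d / (2 * (b - mu)) then
    `[mu - d / (2 * eta), mu + d / (2 * (1 - eta))]
  else
    `[(mu - b * (1 - eta)) / (eta - d / (2 * mu)), b].

(* Main.v *)
Require Import Defs.
From HB Require Import structures.
From mathcomp Require Import all_boot all_order all_algebra.
From mathcomp Require Import all_classical all_reals all_analysis.
From mathcomp Require Import measurable_realfun.
From mathcomp Require Import ring lra.
Import Order.TTheory GRing.Theory Num.Theory.
Import numFieldNormedType.Exports.

Local Open Scope classical_set_scope.
Local Open Scope ring_scope.

(** Write [F q] for [P(D <= q)] and [F(q-)] for [P(D < q)].  Only two facts about
    the critical quantile [q] matter: [F(q-) <= eta <= F q] and [0 <= q <= b].
    The upper bound on [F(q-)] is minimality of [q] passed to the limit from
    the left ([distribution_lt_le]).  The minimum exists because [F] is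
    right-continuous ([cdf_quantile_exists]).

    Optimality is concavity: for a fixed demand the profit lies below its
    tangents, and the one-sided slopes of the expected profit at [q], namely
    [p (1 - F q) - c] on the right and [p (1 - F(q-)) - c] on the left, have the
    right signs because [p eta = p - c] ([quantile_optimal]).

    The bounds on [q] come from linear programming duality.  If an affine
    combination of [x] and [|x - mu|] lies below a multiple of the indicator of
    a ray for all [x] in [[0, b]], then integrating it yields an inequality
    between [mu], [d] and [F] ([mad_indicator_le]).  Each estimate is one such
    dual certificate.
    - The middle interval is Markov's inequality for the two semideviations
      [(mu - D)^+] and [(D - mu)^+], both of mean [d / 2].
    - If [eta < d / (2 mu)], then at least a mass [d / (2 mu) > eta] lies strictly
      below [mu], so [q <= mu], and the certificate that is tight at the
      points [0], [q] and [b] gives the upper end ([low_quantile_bound]).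
    - If [eta > 1 - d / (2 (b - mu))], the situation is the mirror image
      ([high_quantile_bound]).
    The assumption on [d] makes the denominators of the two outer cases
    positive. *)

(** * Integration against a random variable *)

Section expectations.
Context {d : measure_display} {T : measurableType d} {R : realType}.

(** A null set carries no part of either integral, so both may be taken over
    its complement, where the inequality holds everywhere. *)
Lemma ae_le_Rintegral (mu : {measure set T -> \bar R}) (f g : T -> R) :
  mu.-integrable setT (EFin \o f) -> mu.-integrable setT (EFin \o g) ->
  {ae mu, forall t, f t <= g t} ->
  \int[mu]_t f t <= \int[mu]_t g t.
Proof.
move=> intf intg [N [mN N0 fgN]].
rewrite /Rintegral (negligible_integral mN) //.
rewrite [X in _ <= fine X](negligible_integral mN) //.
rewrite setTD; apply: le_Rintegral.
- exact: measurableC.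
- by apply: integrableS intf => //; exact: measurableC.
- by apply: integrableS intg => //; exact: measurableC.
- by move=> t; apply: contra_notP => /fgN.
Qed.

Context {P : probability T R} (X : {RV P >-> R}).

(** The law of [X] as a real number, so that the estimates become ordinary
    real arithmetic. *)
Definition prob (B : set R) : R := fine (distribution P X B).

Lemma probK (B : set R) : measurable B -> (prob B)%:E = distribution P X B.
Proof. by move=> mB; rewrite fineK // fin_num_measure. Qed.

Lemma Rintegral_indic_comp (B : set R) : measurable B ->
  \int[P]_t \1_B (X t) = prob B.
Proof.
move=> mB; have mXB : measurable (X @^-1` B) by exact: measurable_funPTI.
rewrite /Rintegral -[X in fine X]/(\int[P]_t (\1_(X @^-1` B) t)%:E)%E.
by rewrite integral_indic // setIT.
Qed.

Lemma integrable_indic_comp (B : set R) : measurable B ->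
  P.-integrable setT (EFin \o (fun t => \1_B (X t))).
Proof.
move=> mB; have mXB : measurable (X @^-1` B) by exact: measurable_funPTI.
exact: (@integrable_indic _ _ _ P _ mXB).
Qed.

Lemma integrableZ (f : T -> R) (k : R) :
  P.-integrable setT (EFin \o f) ->
  P.-integrable setT (EFin \o (fun t => k * f t)).
Proof. by move=> /(integrableZl measurableT k); exact. Qed.

Lemma integrable_add (f g : T -> R) :
  P.-integrable setT (EFin \o f) -> P.-integrable setT (EFin \o g) ->
  P.-integrable setT (EFin \o (fun t => f t + g t)).
Proof. by move=> intf intg; exact: (integrableD measurableT intf intg). Qed.

Lemma integrable_const (k : R) : P.-integrable setT (EFin \o (fun _ : T => k)).
Proof. exact: finite_measure_integrable_cst. Qed.

Lemma Rintegral_const (k : R) : \int[P]_(t in setT) k = k.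
Proof. by rewrite Rintegral_cst //= probability_setT mulr1. Qed.

(** The ambiguity set, restated for the random variable itself: finiteness of the
    mean absolute deviation becomes integrability, and the support condition
    becomes an almost sure one. *)
Record mad_model (m b dv : R) : Prop := MadModel {
  mad_integrable : P.-integrable setT (EFin \o X);
  mad_support : {ae P, forall t, 0 <= X t <= b};
  mad_mean : \int[P]_t X t = m;
  mad_deviation : \int[P]_t `|X t - m| = dv }.

(** Weak duality for the moment problem: the integrand on the left has a mean
    fixed by the moments, its linear part having mean zero, so every pointwise
    domination is a bound on a tail probability.  The factor [k] may be
    negative, which turns the conclusion into an upper bound. *)
Lemma mad_indicator_le (m b dv : R) (B : set R) (a0 a1 a2 k : R) :
  mad_model m b dv -> measurable B ->
  (forall x : R, 0 <= x <= b ->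
    a0 + a1 * (x - m) + a2 * `|x - m| <= k * \1_B x) ->
  a0 + a2 * dv <= k * prob B.
Proof.
move=> [intX supX EX EaX] mB le.
have intC : P.-integrable setT (EFin \o (fun t => X t - m)).
  by apply: integrable_add => //; exact: integrable_const.
have intA : P.-integrable setT (EFin \o (fun t => `|X t - m|)).
  exact: integrable_norm intC.
have intZ1 := integrableZ (fun t => X t - m) a1 intC.
have intZ2 := integrableZ _ a2 intA.
have intI := integrable_indic_comp B mB.
have int01 := integrable_add _ _ (integrable_const a0) intZ1.
have : \int[P]_t (a0 + a1 * (X t - m) + a2 * `|X t - m|)
       <= \int[P]_t (k * \1_B (X t)).
  apply: ae_le_Rintegral.
  - exact: integrable_add.
  - exact: integrableZ.
  - by apply: filterS supX => t; exact: le.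
rewrite RintegralD // RintegralD //; last exact: integrable_const.
rewrite Rintegral_const !RintegralZl // RintegralB //; last exact: integrable_const.
by rewrite Rintegral_const EX EaX Rintegral_indic_comp // subrr mulr0 addr0.
Qed.

End expectations.

(** * Quantiles *)

Section quantile.
Context {d : measure_display} {T : measurableType d} {R : realType}.
Context {P : probability T R} (X : {RV P >-> R}).

(** The open ray is the increasing union of the closed rays ending at
    [q - 1 / (n + 1)], so continuity of the measure from below applies. *)
Lemma distribution_lt_le (q : R) (e : \bar R) :
  (forall x, x < q -> (cdf X x <= e)%E) ->
  (distribution P X `]-oo, q[%classic <= e)%E.
Proof.
move=> cdf_le.
have -> : `]-oo, q[%classic = \bigcup_n `]-oo, q - n.+1%:R^-1]%classic.
  apply/seteqP; split=> [x /=|x [n _] /=]; rewrite !in_itv /= => xq.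
    have [n nqx] := ltr_add_invr xq.
    by exists n => //=; rewrite in_itv /= lerBrDr ltW.
  by rewrite (le_lt_trans xq) // gtrBl invr_gt0.
have mF n : measurable (`]-oo, q - n.+1%:R^-1] : set R) by [].
apply: (cvge_le _ (nondecreasing_cvg_mu (mu := distribution P X) mF _ _)).
- by apply: nearW => n; apply: cdf_le; rewrite gtrBl invr_gt0.
- exact: bigcup_measurable.
- move=> m n mn; apply/subsetPset; apply: subset_itvl.
  by rewrite bnd_simp lerD2l lerN2 lef_pV2 ?posrE // ler_nat.
Qed.

(** The infimum is attained: every point to its right lies above an admissible
    point, hence is admissible, and the distribution function is
    right-continuous. *)
Lemma cdf_quantile_exists (e : \bar R) :
  has_inf [set x | (e <= cdf X x)%E] ->
  exists q, (e <= cdf X q)%E /\ lbound [set x | (e <= cdf X x)%E] q.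
Proof.
set S := [set x | _] => infS; exists (inf S); split; last first.
  by case: infS => _ /ge_inf.
have [S0 lbS] := infS.
have rcont : cdf X x @[x --> (inf S)^'+] --> cdf X (inf S).
  exact: cdf_right_continuous.
apply: cvge_ge rcont.
near=> x.
have xS : inf S < x by near: x; exact: nbhs_right_gt.
have [y Sy yx] : exists2 y, S y & y < x.
  have [|y Sy] := @inf_adherent _ S (x - inf S) _ infS; first by rewrite subr_gt0.
  by rewrite addrC subrK => yx; exists y.
exact: le_trans Sy (cdf_nondecreasing X (ltW yx)).
Unshelve. all: by end_near. Qed.

End quantile.

(** * Optimality of the critical quantile *)

Section newsvendor.
Context {d : measure_display} {T : measurableType d} {R : realType}.
Context {P : probability T R} (X : {RV P >-> R}).
Context (intX : P.-integrable setT (EFin \o X)).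

Lemma integrable_profit (p c q : R) :
  P.-integrable setT (EFin \o (fun t => profit p c q (X t))).
Proof.
have intM : P.-integrable setT (EFin \o (fun t => Num.min q (X t))).
  have intB : P.-integrable setT (EFin \o (fun t => `|q| + `|X t|)).
    apply: integrable_add; first exact: integrable_const.
    exact: integrable_norm intX.
  move: intB; apply: le_integrable => //.
    by apply/measurable_EFinP; apply: measurable_minr => //.
  move=> t _ /=; rewrite lee_fin [leRHS]ger0_norm ?addr_ge0 //.
  by case: (leP q (X t)) => _; rewrite ?lerDl ?lerDr.
apply: (eq_integrable measurableT
  (EFin \o (fun t => p * Num.min q (X t) + - (c * q)))) => //.
by apply: integrable_add; [exact: integrableZ|exact: integrable_const].
Qed.

Lemma expected_profitE (p c q : R) :
  expected_profit X p c q = (\int[P]_t profit p c q (X t))%:E.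
Proof.
rewrite /expected_profit unlock /Rintegral fineK //.
by apply: integrable_fin_num => //; exact: integrable_profit.
Qed.

(** The concave map [q |-> profit p c q x] lies below its tangents at [q].  At
    the kink [q = x] the two one-sided slopes differ; the strictness of the
    comparison inside [s] selects the slope on the side of [q']. *)
Lemma profit_tangent (p c q q' x s : R) : 0 <= p ->
  (q <= q' /\ s = (x <= q)%R%:R) \/ (q' < q /\ s = (x < q)%R%:R) ->
  profit p c q' x + (q' - q) * (p * s - (p - c)) <= profit p c q x.
Proof.
rewrite /profit => p0 qs.
have -> : p * Num.min q' x - c * q' + (q' - q) * (p * s - (p - c))
   = p * (Num.min q' x + (q' - q) * (s - 1)) - c * q by ring.
rewrite lerD2r ler_wpM2l //.
by case: qs => -[qq' ->]; case: (leP q' x) => ?; case: (ltgtP x q) => ? /=; lra.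
Qed.

(** Integrating the tangent inequality leaves the term
    [(q' - q) (p P(B) - (p - c))], which is nonnegative for the ray [B] chosen on
    the side of [q']. *)
Lemma quantile_optimal (p c q q' : R) : 0 <= p ->
  p * prob X `]-oo, q[ <= p - c -> p - c <= p * prob X `]-oo, q] ->
  (expected_profit X p c q' <= expected_profit X p c q)%E.
Proof.
move=> p0 Flt Fle; rewrite !expected_profitE lee_fin.
pose B : set R := if q <= q' then `]-oo, q]%classic else `]-oo, q[%classic.
have mB : measurable B by rewrite /B; case: ifP.
have intB := integrable_indic_comp X B mB.
have slope : 0 <= (q' - q) * (p * prob X B - (p - c)).
  rewrite /B; case: (leP q q') => qq'; first by rewrite mulr_ge0 // subr_ge0.
  by rewrite mulr_le0 // subr_le0 // ltW.
have : \int[P]_t (profit p c q' (X t) + (q' - q) * (p * \1_B (X t) - (p - c)))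
      <= \int[P]_t profit p c q (X t).
  apply: ae_le_Rintegral.
  - apply: integrable_add; first exact: integrable_profit.
    apply: integrableZ; apply: integrable_add; last exact: integrable_const.
    exact: integrableZ.
  - exact: integrable_profit.
  - apply: aeW => t; apply: profit_tangent => //.
    rewrite /B; case: (leP q q') => qq'; [left|right]; split => //;
      by rewrite indicE mem_setE in_itv.
have intZ := integrableZ _ p intB.
have intD : P.-integrable setT (EFin \o (fun t => p * \1_B (X t) - (p - c))).
  by apply: integrable_add => //; exact: integrable_const.
have slopeE : \int[P]_t (p * \1_B (X t) - (p - c)) = p * prob X B - (p - c).
  rewrite RintegralB //; last exact: integrable_const.
  by rewrite RintegralZl // Rintegral_indic_comp // Rintegral_const.
rewrite RintegralD //; [|exact: integrable_profit|exact: integrableZ].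
rewrite [X in _ + X]RintegralZl // slopeE.
by apply: le_trans; rewrite lerDl.
Qed.

End newsvendor.

(** * Bounds on quantiles from the mean absolute deviation *)

Section quantile_bounds.
Context {dT : measure_display} {T : measurableType dT} {R : realType}.
Context {P : probability T R} (X : {RV P >-> R}) (m b d : R).
Context (XP : mad_model X m b d).

Lemma indic_ltE (q x : R) : \1_(`]-oo, q[ : set R) x = (x < q)%R%:R :> R.
Proof. by rewrite indicE mem_setE in_itv. Qed.

Lemma indic_leE (q x : R) : \1_(`]-oo, q] : set R) x = (x <= q)%R%:R :> R.
Proof. by rewrite indicE mem_setE in_itv. Qed.

(** Markov's inequality for [(m - X)^+ = (|X - m| - (X - m)) / 2], of mean
    [d / 2]. *)
Lemma lower_tail_markov q : 2 * (m - q) * prob X `]-oo, q] <= d.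
Proof.
have : 0 + -1 * d <= - (2 * (m - q)) * prob X `]-oo, q]; last by lra.
apply: (mad_indicator_le X m b d `]-oo, q]%classic
  0 1 (-1) (- (2 * (m - q))) XP)
  => // x x0b; rewrite indic_leE.
by case: (ger0P (x - m)) => ?; case: (lerP x q) => ? /=; lra.
Qed.

(** Markov's inequality for [(X - m)^+ = (|X - m| + (X - m)) / 2]. *)
Lemma upper_tail_markov q : 2 * (q - m) * (1 - prob X `]-oo, q[) <= d.
Proof.
have : 2 * (q - m) + -1 * d <= 2 * (q - m) * prob X `]-oo, q[; last by lra.
apply: (mad_indicator_le X m b d `]-oo, q[%classic
  (2 * (q - m)) (-1) (-1) (2 * (q - m)) XP)
  => // x x0b; rewrite indic_ltE.
by case: (ger0P (x - m)) => ?; case: (ltrP x q) => ? /=; lra.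
Qed.

(** Since [X >= 0], the variable [(m - X)^+] is at most [m] and vanishes outside
    [X < m]; its mean [d / 2] therefore forces some mass there. *)
Lemma lower_tail_mass q : 0 < m -> m <= q -> d <= 2 * m * prob X `]-oo, q[.
Proof.
move=> m0 mq; rewrite -[d]mul1r -[1 * d]add0r.
apply: (mad_indicator_le X m b d `]-oo, q[%classic
  0 (-1) 1 (2 * m) XP)
  => // x /andP[x0 xb]; rewrite indic_ltE.
by case: (ger0P (x - m)) => ?; case: (ltrP x q) => ? /=; lra.
Qed.

(** Here [(X - m)^+] is at most [b - m] and vanishes outside [X > m]. *)
Lemma upper_tail_mass q : m < b -> q <= m ->
  d <= 2 * (b - m) * (1 - prob X `]-oo, q]).
Proof.
move=> mb qm.
have : - (2 * (b - m)) + 1 * d <= - (2 * (b - m)) * prob X `]-oo, q];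
  last by lra.
apply: (mad_indicator_le X m b d `]-oo, q]%classic
  (- (2 * (b - m))) 1 1 (- (2 * (b - m))) XP)
  => // x /andP[x0 xb]; rewrite indic_leE.
by case: (ger0P (x - m)) => ?; case: (lerP x q) => ? /=; lra.
Qed.

(** The certificate is
    [(b - m) (m - x)^+ + (m - q) (x - m)^+ <= (b - m) (q 1_(x < q) + (m - q))],
    with equality at [0], [q] and [b], the support of the worst
    three-point distribution; both semideviations have mean [d / 2]. *)
Lemma low_quantile_bound q : m < b -> 0 <= q -> q <= m ->
  (b - q) * d <=
  2 * (b - m) * (q * prob X `]-oo, q[ + (m - q)).
Proof.
move=> mb q0 qm.
have : - (2 * (b - m) * (m - q)) + (b - q) * d
   <= 2 * (b - m) * q * prob X `]-oo, q[; last by lra.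
apply: (mad_indicator_le X m b d `]-oo, q[%classic
  (- (2 * (b - m) * (m - q))) ((m - q) - (b - m)) (b - q) (2 * (b - m) * q) XP)
  => // x /andP[x0 xb]; rewrite indic_ltE.
by case: (ger0P (x - m)) => ?; case: (ltrP x q) => ? /=; nra.
Qed.

(** The reflection [x |-> b - x] of the previous certificate:
    [m (x - m)^+ + (q - m) (m - x)^+ <= m ((b - q) 1_(x > q) + (q - m))],
    again with equality at [0], [q] and [b]. *)
Lemma high_quantile_bound q : 0 < m -> m <= q -> q <= b ->
  q * d <=
  2 * m * ((b - q) * (1 - prob X `]-oo, q]) + (q - m)).
Proof.
move=> m0 q0 qm.
have : - (2 * m * (b - m)) + q * d
   <= - (2 * m * (b - q)) * prob X `]-oo, q]; last by lra.
apply: (mad_indicator_le X m b d `]-oo, q]%classic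
  (- (2 * m * (b - m))) (m - (q - m)) q (- (2 * m * (b - q))) XP)
  => // x /andP[x0 xb]; rewrite indic_leE.
by case: (ger0P (x - m)) => ?; case: (lerP x q) => ? /=; nra.
Qed.

(** Each case is one of the estimates above, with [F(q-)] or [F q] replaced by
    [eta] and the result solved for [q]. *)
Lemma quantile_in_order_interval (eta q : R) :
  0 < m -> m < b -> 0 < eta < 1 -> 0 <= d -> d <= 2 * m * (b - m) / b ->
  0 <= q <= b -> prob X `]-oo, q[ <= eta -> eta <= prob X `]-oo, q] ->
  q \in order_interval m b d eta.
Proof.
move=> m0 mb /andP[eta0 eta1] d0 + /andP[q0 qb] Flt Fle.
have b0 : 0 < b by exact: lt_trans mb.
have bm0 : 0 < b - m by rewrite subr_gt0.
rewrite ler_pdivlMr // => dmax; rewrite /order_interval.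
case: ifPn => [|_].
  rewrite ltr_pdivlMr ?mulr_gt0 // => etad.
  have qm : q <= m.
    (* Otherwise the mass d / (2 m) > eta would lie strictly below q. *)
    rewrite leNgt; apply/negP => /ltW /(lower_tail_mass _ m0); nra.
  have := low_quantile_bound _ mb q0 qm.
  (* Times m, the denominator exceeds 2 m (b - m) - b d, as 2 m eta < d. *)
  have den0 : 0 < 2 * (b - m) * (1 - eta) - d by nra.
  rewrite in_itv /= q0 /= ler_pdivlMr // => bound.
  have : 2 * (b - m) * (q * prob X `]-oo, q[ + (m - q))
      <= 2 * (b - m) * (q * eta + (m - q)).
    by rewrite ler_pM2l ?mulr_gt0 // lerD2r ler_wpM2l.
  lra.
case: ifPn => [_|].
  rewrite in_itv /= lerBlDr -lerBlDl -lerBlDl !ler_pdivlMr ?mulr_gt0 ?subr_gt0 //.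
  have := lower_tail_markov q; have := upper_tail_markov q => H1 H2.
  apply/andP; split.
    by case: (lerP q m) => qm; nra.
  by case: (lerP q m) => qm; nra.
rewrite -ltNge ltrBlDl -ltrBlDr ltr_pdivlMr ?mulr_gt0 // => etad.
have mq : m <= q.
  (* Otherwise a mass d / (2 (b - m)) > 1 - eta would lie strictly above q. *)
  rewrite leNgt; apply/negP => /ltW /(upper_tail_mass _ mb); nra.
have bound := high_quantile_bound _ m0 mq qb.
have mden0 : d < eta * (2 * m) by nra.
have den0 : 0 < eta - d / (2 * m) by rewrite subr_gt0 ltr_pdivrMr ?mulr_gt0.
rewrite in_itv /= qb andbT ler_pdivrMr //.
have -> : q * (eta - d / (2 * m)) = (q * (eta * (2 * m) - d)) / (2 * m).
  by field; rewrite lt0r_neq0.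
rewrite ler_pdivlMr ?mulr_gt0 //.
have : 2 * m * ((b - q) * (1 - prob X `]-oo, q]) + (q - m))
      <= 2 * m * ((b - q) * (1 - eta) + (q - m)).
  by rewrite ler_pM2l ?mulr_gt0 // lerD2r ler_wpM2l ?subr_ge0 // lerD2l lerN2.
lra.
Qed.

End quantile_bounds.

(** * The ambiguity set *)

Lemma probability_setC_eq0 {dT : measure_display} {T : measurableType dT}
    {R : realType} (P : probability T R) (A : set T) :
  measurable A -> P A = 1%E -> P (~` A) = 0%E.
Proof. by move=> mA PA; rewrite probability_setC // PA subee. Qed.

Section ambiguity.
Context {dT : measure_display} {T : measurableType dT} {R : realType}.
Context {P : probability T R} (X : {RV P >-> R}).

Lemma ambiguity_set_mad_model (m b d : R) :
  ambiguity_set m b d (distribution P X) -> mad_model X m b d.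
Proof.
rewrite /ambiguity_set /= !unlock => -[supX EX EaX].
have mdev : measurable_fun setT (fun x : R => `|x - m|).
  by apply: measurableT_comp => //; exact: measurable_funB.
have EaXP : (\int[P]_t `|X t - m|%:E = d%:E)%E.
  rewrite -EaX (ge0_integral_distribution X) //.
  exact/measurable_EFinP.
have intC : P.-integrable setT (EFin \o (fun t => X t - m)).
  apply/integrableP; split.
    by apply/measurable_EFinP; exact: measurable_funB.
  by rewrite (_ : (\int[P]_t _)%E = d%:E) ?ltry.
have intX : P.-integrable setT (EFin \o X).
  apply: (eq_integrable measurableT (EFin \o (fun t => (X t - m) + m))).
    by move=> t _ /=; rewrite subrK.
  by apply: integrable_add => //; exact: integrable_const.
split => //.
- exists (X @^-1` (~` `[0, b]%classic)); split.
  + by apply: measurable_funPTI => //; exact: measurableC.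
  + rewrite -[LHS]/(distribution P X (~` `[0, b]%classic)).
    exact: (probability_setC_eq0 _ _ _ supX).
  + by move=> t /=; rewrite in_itv.
- rewrite /Rintegral -[LHS]/(fine (\int[P]_t (EFin \o X) t)%E).
  by rewrite -integral_distribution ?EX //; exact/measurable_EFinP.
- by rewrite /Rintegral EaXP.
Qed.

End ambiguity.

Theorem theorem5 (R : realType) (mu b d p c : R)
    (dT : measure_display) (T : measurableType dT) (Pr : probability T R)
    (D : {RV Pr >-> R}) :
  0 < mu -> mu < b ->
  0 <= d -> d <= 2 * mu * (b - mu) / b ->
  0 < c -> c < p ->
  ambiguity_set mu b d (distribution Pr D) ->
  (exists q, optimal_order_quantity D p c q) /\
  (forall q, optimal_order_quantity D p c q ->
     (forall q', (expected_profit D p c q' <= expected_profit D p c q)%E) /\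
     q \in order_interval mu b d (critical_ratio p c)).
Proof.
move=> mu0 mub d0 dmax c0 cp DP.
have DM := ambiguity_set_mad_model _ _ _ _ DP.
have [supD _ _] := DP.
have p0 : 0 < p by exact: lt_trans cp.
pose eta := critical_ratio p c.
have etaE : p * eta = p - c by rewrite /eta /critical_ratio mulrC divfK ?lt0r_neq0.
have eta01 : 0 < eta < 1.
  by rewrite /eta /critical_ratio divr_gt0 ?subr_gt0 // ltr_pdivrMr // mul1r gtrBl.
have [eta0 eta1] := andP eta01.
(* The next two facts make the set of admissible quantities nonempty and
   bounded below, and confine its minimum to the support of the demand. *)
have b_adm : (eta%:E <= cdf D b)%E.
  apply: (@le_trans _ _ 1%E); first by rewrite lee_fin ltW.
  rewrite -supD; apply: le_measure; rewrite ?inE //; exact: subset_itvr.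
have adm_ge0 x : (eta%:E <= cdf D x)%E -> 0 <= x.
  apply: contraTT; rewrite -!ltNge => x0.
  suff -> : cdf D x = 0%E by rewrite lte_fin.
  apply/eqP; rewrite eq_le cdf_ge0 andbT.
  have -> : 0%E = distribution Pr D (~` `[0, b]%classic).
    by rewrite (probability_setC_eq0 _ _ _ supD).
  apply: le_measure; rewrite ?inE //; first exact: measurableC.
  move=> y /=; rewrite !in_itv /= => /le_lt_trans/(_ x0).
  by rewrite ltNge => /negP y0 /andP[].
split.
  by apply: cdf_quantile_exists; split; [exists b|exists 0 => x /adm_ge0].
move=> q [/= qadm qmin].
have Fle : eta <= prob D `]-oo, q] by rewrite -lee_fin probK.
have Flt : prob D `]-oo, q[ <= eta.
  rewrite -lee_fin probK //; apply: distribution_lt_le => x xq.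
  by rewrite leNgt; apply: contraTN xq => /ltW /qmin; rewrite leNgt.
split=> [q'|].
  apply: (quantile_optimal D (mad_integrable _ _ _ _ DM)); first exact: ltW.
  - by rewrite -etaE ler_pM2l.
  - by rewrite -etaE ler_pM2l.
apply: (quantile_in_order_interval D _ _ _ DM) => //.
by rewrite adm_ge0 // qmin.
Qed.
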